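(* Given $\delta\in(0,1]$, suppose that probabilistic adversarial attacks $w_t$ are designed by an adversary to satisfy $\sigma_w=\left(\frac1\rho\right)^{\Omega(\tau\log(T/\delta))}$, where $0<\rho<1$ is the contraction factor of $f$, $\tau$ is the input memory length, $T$ is the time horizon and $\sigma_w$ is the sub-Gaussian norm bound on the disturbances. Then, there exists a problem instance satisfying the assumptions (Lipschitz continuity), (Basis functions), (Sub-Gaussian control inputs), (Sub-Gaussian disturbances) and (Probabilistic adversarial attack) listed in the context that suffers from $\Omega\left(\frac{\rho^\tau L}{\lambda}\right)$ estimation error with probability at least $1-\delta$ for any estimator.
   Context: Setting: a problem instance consists of a system $x_{t+1}=f(x_t,u_t,w_t)$, $y_t=g(x_t,u_t)$, $t=0,\dots,T-1$, with $f:\mathbb{R}^n\times\mathcal{U}\times\mathbb{R}^d\to\mathbb{R}^n$, $g:\mathbb{R}^n\times\mathcal{U}\to\mathbb{R}^r$, states $x_t\in\mathbb{R}^n$, inputs $u_t\in\mathcal{U}\subset\mathbb{R}^m$, disturbances $w_t\in\mathbb{R}^d$, observations $y_t\in\mathbb{R}^r$, together with basis functions $\Phi=[\phi_1~\cdots~\phi_M]^T$, $\phi_i:(\mathbb{R}^m)^{\tau+1}\to\mathbb{R}$. Write $\mathbf{U}_t^{(\tau)}=(u_t,\dots,u_{t-\tau})$ and $\mathcal{F}_t=\sigma\{x_0,\dots,x_t\}$ (generated sigma-algebra). The assumptions are: - (Lipschitz continuity) $\|g(x,u)-g(\tilde x,\tilde u)\|_2\le L(\|x-\tilde x\|_2+\|u-\tilde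 u\|_2)$ for all $x,\tilde x\in\mathbb{R}^n$, $u,\tilde u\in\mathcal{U}$, for some $L>0$; there are $C>0$ and $0<\rho<1$ such that for every $k\ge1$ the $k$-fold composition $f^{(k)}$ of the dynamics (the map sending $(x_{t-k},u_{t-k},\dots,u_{t-1},w_{t-k},\dots,w_{t-1})$ to $x_t$) is Lipschitz in its oldest arguments $(x_{t-k},u_{t-k},w_{t-k})$ with constant $C\rho^k$ with respect to $\|x\|_2+\|u\|_2+\|w\|_2$, for any fixed later inputs and disturbances ($\rho$ is called the contraction factor of $f$); and $f(0,0,0)=0$. - (Basis functions) Each $\phi_i$ is $L_\phi$-Lipschitz on $(\mathcal{U})^{\tau+1}$ in the Euclidean norm; there is a universal constant $\lambda>0$ with $\mathbb{E}[\Phi(\mathbf{U}_t^{(\tau)})\Phi(\mathbf{U}_t^{(\tau)})^T]\succeq\lambda^2I_M$ for all $t\ge\tau$; and $\Phi(0)=0$. - (Sub-Gaussian control inputs) $u_0,\dots,u_{T-1}$ are independent of each other and $\|u_t\|_{\psi_2}\le\sigma_u$ for all $t$, for some finite $\sigma_u>0$. - (Sub-Gaussian disturbances) There is $\sigma_w>0$ with $\|x_0\|_{\psi_2}\le\sigma_w$ and, conditioned on $\mathcal{F}_t$, $\|w_t\|_{\psi_2}\le\sigma_w$ for all $t=0,\dots,T-1$ and $\mathcal{F}_t$. - (Probabilistic adversarial attack) $w_t$ is an adversarial attack at each time $t$ with probability $p<\frac1{2\tau}$ conditioned on $\mathcal{F}_t$; i.e., there exists a sequence $(\xi_t)_{t\ge0}$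 of independent $\mathrm{Bernoulli}(p)$ variables such that $\{\xi_t=0\}\subseteq\{w_t=0\}$ for all $t\ge0$. Estimation target and error: the true input-output mapping is represented by a matrix $G^*\in\mathbb{R}^{r\times M}$ with $g(f(\cdots f(0,u_{t-\tau},0),\cdots,u_{t-1},0),u_t)=G^*\cdot\Phi(\mathbf{U}_t^{(\tau)})+\epsilon_t(\mathbf{U}_t^{(\tau)})$ for $t\ge\tau$, where $\|\epsilon_t(\mathbf{U}_t^{(\tau)})\|_2\le\bar\epsilon$ for an approximation tolerance $\bar\epsilon\ge0$. An estimator produces an estimate $\hat G_T$ of $G^*$ from the inputs $\{u_t\}_{t=0}^{T-1}$ and observations $\{y_t\}_{t=0}^{T-1}$; its estimation error is $\|G^*-\hat G_T\|_F$ (Frobenius norm). Sub-Gaussian norms: for scalars $\|w\|_{\psi_2}=\inf\{c>0:\mathbb{E}[\exp(w^2/c^2)]\le2\}$; for vectors $\|w\|_{\psi_2}=\sup_{\|x\|_2\le1}\|w^Tx\|_{\psi_2}$, and with this definition the paper takes the sub-Gaussian norm of the scalar $\|w\|_2$ to be equal to that of $w$. $\Omega(\cdot)$ is the usual big-$\Omega$ notation. *)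

(* Defs.v *)
From HB Require Import structures.
From mathcomp Require Import all_boot all_order all_algebra.
From mathcomp Require Import all_classical all_reals all_analysis.

Set Implicit Arguments.
Unset Strict Implicit.
Unset Printing Implicit Defensive.

Import Order.TTheory GRing.Theory Num.Theory.
Import numFieldNormedType.Exports.

Local Open Scope classical_set_scope.
Local Open Scope ring_scope.

Section Linear.
Variable R : realType.

(* Euclidean norm of a column vector and Frobenius norm of a matrix; on
   'M_(m, k) it is also the Euclidean norm of a k-tuple of vectors of R^m. *)
Definition l2norm m n (A : 'M[R]_(m, n)) : R :=
  Num.sqrt (\sum_(i < m) \sum_(j < n) A i j ^+ 2).

Definition psd n (A : 'M[R]_n) : Prop :=
  A^T = A /\ forall v : 'cV[R]_n, 0 <= (v^T *m A *m v) 0 0.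

(* R^n with its Borel (= product) sigma-algebra. *)
Definition Rn (n : nat) :=
  g_sigma_algebraType
    (g_sigma_preimage (fun (i : 'I_n) (x : 'cV[R]_n) => x i 0)).

End Linear.

Section Dynamics.
Variables (R : realType) (n m d r : nat).
Implicit Types (U : set 'cV[R]_m)
  (f : 'cV[R]_n -> 'cV[R]_m -> 'cV[R]_d -> 'cV[R]_n)
  (g : 'cV[R]_n -> 'cV[R]_m -> 'cV[R]_r).

(* The k-fold composition f^(k): the state reached from x after k steps; us and
   ws list the inputs and disturbances from the oldest (index 0) on. *)
Fixpoint flow f (k : nat) (x : 'cV[R]_n) (us : nat -> 'cV[R]_m)
    (ws : nat -> 'cV[R]_d) : 'cV[R]_n :=
  if k is k'.+1 then f (flow f k' x us ws) (us k') (ws k') else x.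

Definition lipschitz_assumption U f g (L C rho : R) : Prop :=
  [/\ forall x x' u u', U u -> U u' ->
        l2norm (g x u - g x' u') <= L * (l2norm (x - x') + l2norm (u - u')),
      forall k, (1 <= k)%N -> forall x x' us us' ws ws',
        (forall i, (i < k)%N -> U (us i) /\ U (us' i)) ->
        (forall i, (0 < i < k)%N -> us i = us' i /\ ws i = ws' i) ->
        l2norm (flow f k x us ws - flow f k x' us' ws')
          <= C * rho ^+ k * (l2norm (x - x') + l2norm (us 0%N - us' 0%N)
                             + l2norm (ws 0%N - ws' 0%N))
    & U 0 /\ f 0 0 0 = 0].

(* A window (u_t, ..., u_(t-tau)) of inputs is the matrix whose j-th column is
   u_(t-j). *)
Definition window_in U tau (V : 'M[R]_(m, tau.+1)) : Prop :=
  forall j, U (col j V).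

(* g(f(...f(0, u_(t-tau), 0)..., u_(t-1), 0), u_t) *)
Definition io_map f g tau (V : 'M[R]_(m, tau.+1)) : 'cV[R]_r :=
  g (flow f tau 0 (fun s => col (inord (tau - s)) V) (fun=> 0)) (col 0 V).

Definition io_representation U f g tau M (Phi : 'M[R]_(m, tau.+1) -> 'cV[R]_M)
    (Gstar : 'M[R]_(r, M)) (epsbar : R) : Prop :=
  forall V, window_in U V -> l2norm (io_map f g V - Gstar *m Phi V) <= epsbar.

End Dynamics.

Section SubGaussian.
Variables (R : realType) (dO : measure_display) (Omega : measurableType dO).

Definition psi2 (mu : {measure set Omega -> \bar R}) (X : Omega -> R) : \bar R :=
  ereal_inf [set c%:E | c in [set c : R | 0 < c /\
    (\int[mu]_o (expR (X o ^+ 2 / c ^+ 2))%:E <= 2%:E)%E]].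

Definition vpsi2 k (mu : {measure set Omega -> \bar R})
    (X : Omega -> 'cV[R]_k) : \bar R :=
  ereal_sup [set psi2 mu (fun o => ((X o)^T *m v) 0 0) |
    v in [set v : 'cV[R]_k | l2norm v <= 1]].

(* The vector norm is identified with the psi2-norm of the scalar |X|_2; in
   dimension > 1 the latter can be larger, so the bound is asked of both. *)
Definition subgaussian k (mu : {measure set Omega -> \bar R})
    (X : Omega -> 'cV[R]_k) (sigma : R) : Prop :=
  (vpsi2 mu X <= sigma%:E)%E /\
  (psi2 mu (fun o => l2norm (X o)) <= sigma%:E)%E.

End SubGaussian.

Section Probability.
Variables (R : realType) (dO : measure_display) (Omega : measurableType dO).

(* Joint independence of X_0, ..., X_(T-1); subfamilies are covered by taking
   some of the B t to be setT. *)
Definition independent_family d' (E : measurableType d') (P : probability Omega R)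
    (T : nat) (X : nat -> Omega -> E) : Prop :=
  forall B : nat -> set E, (forall t, measurable (B t)) ->
    P (\bigcap_(t in `I_T) (X t @^-1` B t)) =
    (\prod_(t < T) P (X t @^-1` B t))%E.

Variables (n m d : nat).
Implicit Types (P : probability Omega R) (u : nat -> Omega -> 'cV[R]_m)
  (w : nat -> Omega -> 'cV[R]_d) (x : nat -> Omega -> 'cV[R]_n).

Definition trajectory (f : 'cV[R]_n -> 'cV[R]_m -> 'cV[R]_d -> 'cV[R]_n)
    (x0 : Omega -> 'cV[R]_n) u w (t : nat) (o : Omega) : 'cV[R]_n :=
  flow f t (x0 o) (u ^~ o) (w ^~ o).

(* Events generating F_t = sigma(x_0, ..., x_t), which is <<s history x t>>. *)
Definition history x (t : nat) : set (set Omega) :=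
  \bigcup_(s in `I_t.+1)
    preimage_set_system setT (x s) (measurable : set (set (Rn R n))).

Definition input_window tau u (t : nat) (o : Omega) : 'M[R]_(m, tau.+1) :=
  \matrix_(i, j) u (t - j)%N o i 0.

Definition second_moment M P (Z : Omega -> 'cV[R]_M) : 'M[R]_M :=
  \matrix_(i, j) fine 'E_P[fun o => Z o i 0 * Z o j 0].

Definition basis_assumption P (T tau M : nat) (U : set 'cV[R]_m) u
    (Phi : 'M[R]_(m, tau.+1) -> 'cV[R]_M) (Lphi lambda : R) : Prop :=
  [/\ forall i V V', window_in U V -> window_in U V' ->
        `|Phi V i 0 - Phi V' i 0| <= Lphi * l2norm (V - V'),
      forall t, (tau <= t < T)%N ->
        psd (second_moment P (fun o => Phi (input_window tau u t o))
             - (lambda ^+ 2)%:M)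
    & Phi 0 = 0].

Definition input_assumption P (T : nat) (U : set 'cV[R]_m) u (sigma_u : R) :
    Prop :=
  [/\ forall t, (t < T)%N ->
        measurable_fun setT (u t : Omega -> Rn R m) /\ forall o, U (u t o),
      independent_family P T (u : nat -> Omega -> Rn R m)
    & forall t, (t < T)%N -> subgaussian P (u t) sigma_u].

(* kappa is a regular conditional law of X given the sigma-algebra <<s G>>. *)
Definition conditional_law P (G : set (set Omega)) k (X : Omega -> 'cV[R]_k)
    (kappa : R.-pker (g_sigma_algebraType G) ~> Rn R k) : Prop :=
  forall (A : set Omega) (B : set (Rn R k)), <<s G >> A -> measurable B ->
    P (A `&` X @^-1` B) = (\int[P]_(o in A) kappa o B)%E.

Definition disturbance_assumption P (T : nat) x w (sigma_w : R) : Prop :=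
  [/\ measurable_fun setT (x 0%N : Omega -> Rn R n),
      subgaussian P (x 0%N) sigma_w
    & forall t, (t < T)%N ->
        measurable_fun setT (w t : Omega -> Rn R d) /\
        exists2 kappa, conditional_law P (G := history x t) (w t) kappa &
          {ae P, forall o : Omega,
            subgaussian (kappa o) (fun v : Rn R d => v : 'cV[R]_d) sigma_w}].

(* The attack indicator xi_t is Bernoulli(p) conditionally on F_t. *)
Definition attack_assumption P (T tau : nat) x w (p : R) : Prop :=
  [/\ 0 <= p, p < (2 * tau%:R)^-1 &
    exists xi : nat -> Omega -> bool,
    [/\ forall t, (t < T)%N -> measurable_fun setT (xi t),
        independent_family P T xi,
        forall t, (t < T)%N -> P (xi t @^-1` [set true]) = p%:E,
        forall t, (t < T)%N -> forall A, <<s history x t >> A ->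
          P (A `&` xi t @^-1` [set true]) = (p%:E * P A)%E
      & forall t, (t < T)%N -> forall o, xi t o = false -> w t o = 0]].

End Probability.

(* Data (inputs and observations as the columns of two matrices) to estimate. *)
Definition estimator (R : realType) (m r M T : nat) :=
  'M[R]_(m, T) -> 'M[R]_(r, T) -> 'M[R]_(r, M).

Definition estimate (R : realType) dO (Omega : measurableType dO)
    (n m r M T : nat) (Ghat : estimator R m r M T)
    (g : 'cV[R]_n -> 'cV[R]_m -> 'cV[R]_r) (x : nat -> Omega -> 'cV[R]_n)
    (u : nat -> Omega -> 'cV[R]_m) (o : Omega) : 'M[R]_(r, M) :=
  Ghat (\matrix_(i, t) u t o i 0) (\matrix_(i, t) g (x t o) (u t o) i 0).

(* Main.v *)
(* Everything is one-dimensional.  The state x_(t+1) = rho (x_t + w_t) ignores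
   the input, and the observation is k u_t max(0, 1 - |x_t| / s) with k = +-L,
   so that it vanishes as soon as |x_t| >= s.  Along the unattacked dynamics
   started at 0 the state is 0, hence the input-output map is k u_t: the sign of
   k matters there, but it is invisible on data with |x_t| >= s for all t.
   The initial state and every attack have size sigma_w / 2, so an attack at most
   a + 1 steps old still leaves x_t >= rho / 2 >= s when sigma_w = rho^(-a).
   Attacks being independent of probability 1 / (4 tau), the union bound over
   the windows of that length shows that x_t >= s for all t < T with probability
   at least 1 - delta.  Then the estimator sees zero outputs whatever the sign of
   k, and one of the two signs is at distance at least L s / lambda from its
   answer; s is of order rho^tau. *)
Require Import Defs.
From HB Require Import structures.
From mathcomp Require Import all_boot all_order all_algebra.
From mathcomp Require Import all_classical all_reals all_analysis.
From mathcomp Require Import measurable_realfun.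
From mathcomp Require Import ring lra.

Set Implicit Arguments.
Unset Strict Implicit.
Unset Printing Implicit Defensive.

Import Order.TTheory GRing.Theory Num.Theory.
Import numFieldNormedType.Exports.

Local Open Scope classical_set_scope.
Local Open Scope ring_scope.

(** * The finite probability space of [T] independent biased coin flips *)

Definition flips (T : nat) := {ffun 'I_T -> bool}.

HB.instance Definition _ T := Finite.on (flips T).
HB.instance Definition _ T := isPointed.Build (flips T) [ffun=> false].
(** The discrete sigma-algebra makes every map out of [flips T] measurable. *)
HB.instance Definition _ T := @isMeasurable.Build default_measure_display
  (flips T) discrete_measurable discrete_measurable0
  discrete_measurableC discrete_measurableU.

Lemma measurable_fun_flips T d (E : measurableType d) (X : flips T -> E) :
  measurable_fun setT X.
Proof. by []. Qed.

(* [false] when [t] is not below [T]. *)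
Definition flip T (t : nat) (o : flips T) : bool := oapp o false (insub t).

Lemma flip_ord T (i : 'I_T) (o : flips T) : flip i o = o i.
Proof. by rewrite /flip valK. Qed.

Section FlipsProbability.
Variables (R : realType) (T : nat) (p : R).
Hypothesis p01 : 0 <= p <= 1.

Definition coin (b : bool) : R := if b then p else 1 - p.

Definition weight (o : flips T) : R := \prod_i coin (o i).

Lemma coin_ge0 b : 0 <= coin b.
Proof. by case/andP: p01 => p0 p1; case: b => //=; rewrite subr_ge0. Qed.

Lemma weight_ge0 o : 0 <= weight o.
Proof. by apply: prodr_ge0 => i _; exact: coin_ge0. Qed.

(** A finite combination of Dirac masses, so that the measure structure is inferred; the default of
    [nth] is never reached, as the index stays below the cardinal. *)
Definition flips_prob : set (flips T) -> \bar R :=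
  msum (fun k => let o : flips T := nth [ffun=> false] (enum (flips T)) k in
    mscale (NngNum (weight_ge0 o)) (dirac o)) #|flips T|.

HB.instance Definition _ := Measure.on flips_prob.

Lemma flips_probE (A : set (flips T)) :
  flips_prob A = (\sum_(o : flips T | o \in A) weight o)%:E.
Proof.
rewrite /flips_prob /msum /=.
under eq_bigr do rewrite /mscale /= diracE -EFinM.
rewrite sumEFin; congr (_%:E).
pose F (o : flips T) := weight o * (o \in A)%:R.
rewrite -(big_mkord xpredT
  (fun k => F (nth [ffun=> false] (enum (flips T)) k))).
rewrite cardE -(big_nth _ xpredT F) big_enum [RHS]big_mkcond /=.
by apply: eq_bigr => o _; rewrite /F; case: (o \in A); rewrite ?mulr1 ?mulr0.
Qed.

(** Expanding the product of sums yields one term per outcome, and outcomes outside the box get a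
    zero factor. Marginals and independence are both read off from this formula. *)
Lemma flips_prob_rect (B : 'I_T -> set bool) :
  flips_prob [set o | forall i, B i (o i)] =
  (\prod_i \sum_(b | b \in B i) coin b)%:E.
Proof.
rewrite flips_probE; congr (_%:E).
under [RHS]eq_bigr do rewrite big_mkcond /=.
rewrite bigA_distr_bigA big_mkcond /=; apply: eq_bigr => o _.
case: ifPn => [|]; rewrite ?inE ?notin_setE /= => Bo.
  by apply: eq_bigr => i _; rewrite mem_set.
have [i Bi] : exists i, ~ B i (o i) by apply/existsNP.
by rewrite (bigD1 i) //= memNset // mul0r.
Qed.

Lemma flips_prob_setT : flips_prob setT = 1%E.
Proof.
have := flips_prob_rect (fun=> setT).
rewrite big1 => [<-|i _]; first by congr flips_prob; apply/seteqP; split.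
rewrite (eq_bigl xpredT) => [|b]; last by rewrite in_setT.
by rewrite big_bool /coin /=; lra.
Qed.

HB.instance Definition _ :=
  Measure_isProbability.Build _ _ _ flips_prob flips_prob_setT.

Lemma flips_prob_flip (i : 'I_T) (B : set bool) :
  flips_prob (flip i @^-1` B) = (\sum_(b | b \in B) coin b)%:E.
Proof.
have -> : @flip T i @^-1` B =
    [set o | forall j, (if j == i then B else setT) (o j)].
  apply/seteqP; split => o /=; rewrite flip_ord.
    by move=> Bo j; case: eqP => // ->.
  by move=> /(_ i); rewrite eqxx.
rewrite (flips_prob_rect (fun j => if j == i then B else setT)).
rewrite (bigD1 i) //= eqxx [X in _ * X]big1 ?mulr1 // => j /negPf ->.
rewrite (eq_bigl xpredT) => [|b]; last by rewrite in_setT.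
by rewrite big_bool /coin /=; lra.
Qed.

Lemma flips_prob_flip1 t b : (t < T)%N ->
  flips_prob (flip t @^-1` [set b]) = (coin b)%:E.
Proof.
move=> tT; rewrite -[t]/(nat_of_ord (Ordinal tT)) flips_prob_flip.
rewrite (eq_bigl (pred1 b)) ?big_pred1_eq // => c.
by apply/idP/eqP => [|->]; rewrite inE.
Qed.

Lemma flips_independent :
  independent_family (flips_prob : probability (flips T) R) T (@flip T).
Proof.
move=> B _; rewrite (eq_bigr (fun i : 'I_T =>
  (\sum_(b | b \in B i) coin b)%:E));
  last by move=> i _; exact: flips_prob_flip.
rewrite prodEFin -(flips_prob_rect (fun i => B i)); congr flips_prob.
apply/seteqP; split => o /= Bo.
  by move=> i; have := Bo i (ltn_ord i); rewrite /= flip_ord.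
by move=> t /= tT; have := Bo (Ordinal tT); rewrite -flip_ord.
Qed.

End FlipsProbability.

(** * Events determined by past flips, and their independence from the next flip *)

Definition determined T (t : nat) (A : set (flips T)) : Prop :=
  forall o o' : flips T, (forall i : 'I_T, (i < t)%N -> o i = o' i) ->
    A o -> A o'.

(** The events determined by the first [t] flips form a sigma-algebra; closure under complement uses
    the symmetry of the agreement condition in [o] and [o']. *)
Lemma sigma_determined T (t : nat) (G : set (set (flips T))) :
  (forall A, G A -> determined t A) -> forall A, <<s G >> A -> determined t A.
Proof.
move=> GD; apply: smallest_sub GD; split => //.
- move=> A DA o o' oo' [_ nAo]; split=> // Ao'; apply: nAo.
  by apply: DA Ao' => i /oo'.
- by move=> F DF o o' oo' [k _ Fo]; exists k => //; exact: DF Fo.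
Qed.

Section Independence.
Variables (R : realType) (T : nat) (p : R).
Hypothesis p01 : 0 <= p <= 1.

Let P : probability (flips T) R := flips_prob p01.

Definition toggle (i : 'I_T) (o : flips T) : flips T :=
  [ffun j => if j == i then ~~ o j else o j].

Lemma toggleK i : involutive (toggle i).
Proof.
by move=> o; apply/ffunP => j; rewrite !ffunE; case: eqP; rewrite ?negbK.
Qed.

Lemma toggle_determined (i : 'I_T) (A : set (flips T)) o :
  determined i A -> (toggle i o \in A) = (o \in A).
Proof.
have agree (o' : flips T) (j : 'I_T) : (j < i)%N -> o' j = toggle i o' j.
  by rewrite ffunE; case: eqP => // ->; rewrite ltnn.
move=> DA; apply/idP/idP; rewrite !inE; apply: DA => j ji.
  by rewrite -agree.
exact: agree.
Qed.

Lemma weight_slice (i : 'I_T) (A : set (flips T)) (b : bool) :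
  determined i A ->
  \sum_(o : flips T | (o \in A) && (o i == b)) weight p o =
  coin p b * \sum_(o : flips T | o \in A) weight p o.
Proof.
move=> DA.
(* Toggling the i-th flip, which [A] ignores, exchanges the two slices. *)
pose S c := \sum_(o : flips T | (o \in A) && (o i == c))
  \prod_(j | j != i) coin p (o j).
have sliceE c : \sum_(o : flips T | (o \in A) && (o i == c)) weight p o =
    coin p c * S c.
  rewrite mulr_sumr; apply: eq_bigr => o /andP[_ /eqP <-].
  by rewrite /weight (bigD1 i).
have SE c : S c = S (~~ c).
  rewrite /S (reindex_inj (inv_inj (toggleK i))) /=; apply: eq_big => [x|x _].
    rewrite (toggle_determined _ DA) ffunE eqxx.
    by case: (x i); case: c.
  by apply: eq_bigr => j /negPf ji; rewrite ffunE ji.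
have -> : \sum_(o : flips T | o \in A) weight p o = S b.
  rewrite (bigID (fun o : flips T => o i == b)) /=.
  rewrite [X in _ + X](eq_bigl
    (fun o : flips T => (o \in A) && (o i == ~~ b))); last first.
    by move=> o; case: (o i); case: b.
  rewrite !sliceE -SE -mulrDl /coin; case: b; rewrite /=; lra.
exact: sliceE.
Qed.

(** Splitting on the value of flip [t] reduces the claim to [weight_slice]. This is what makes an
    attack independent of the history. *)
Lemma flips_prob_indep (t : nat) (A : set (flips T)) (B : set bool) :
  (t < T)%N -> determined t A ->
  P (A `&` flip t @^-1` B) = (P A * P (flip t @^-1` B))%E.
Proof.
move=> tT; rewrite -[t]/(nat_of_ord (Ordinal tT)); move: (Ordinal tT) => i DA.
have PE C : P C = (\sum_(o : flips T | o \in C) weight p o)%:E.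
  exact: flips_probE.
rewrite [X in (_ * X)%E]flips_prob_flip !PE -EFinM; congr _%:E.
rewrite (partition_big (fun o : flips T => o i) (mem B)) /=; last first.
  by move=> o; rewrite !inE /= flip_ord => -[].
rewrite mulrC mulr_suml; apply: eq_bigr => b bB.
rewrite -(weight_slice b DA); apply: eq_bigl => o.
apply/andP/andP => -[]; rewrite !inE /=.
  by move=> [? _] ->.
move=> Ao /eqP oib; rewrite flip_ord oib eqxx; split=> //; split=> //.
exact/set_mem.
Qed.

End Independence.

(** * Bounded variables are sub-Gaussian; constants are independent *)

Section OneDimensional.
Variable R : realType.

Lemma l2norm11 (A : 'M[R]_1) : l2norm A = `|A 0 0|.
Proof. by rewrite /l2norm !big_ord1 sqrtr_sqr. Qed.

Lemma dot11 (x y : 'cV[R]_1) : (x^T *m y) 0 0 = x 0 0 * y 0 0.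
Proof. by rewrite !mxE big_ord1 mxE. Qed.

Lemma measurable_coord n (i : 'I_n) :
  measurable_fun setT ((fun y => y i 0) : Rn R n -> R).
Proof.
move=> _ B mB.
(* The sigma-algebra of [Rn] is generated by a system that is itself a generated sigma-algebra,
   hence two passes. *)
suff gen : g_sigma_preimage (fun (j : 'I_n) (y : 'cV[R]_n) => y j 0)
    (setT `&` (fun y : 'cV[R]_n => y i 0) @^-1` B).
  exact: sub_sigma_algebra gen.
by apply: sub_sigma_algebra; rewrite (bigD1 i) //=; left; exists B.
Qed.

Section SubGaussianBounded.
Variables (dO : measure_display) (Omega : measurableType dO).
Variables (P : probability Omega R) (sigma : R).
Hypothesis sigma_gt0 : 0 < sigma.

Lemma integral_expR_sqr_le2 (X : Omega -> R) :
  measurable_fun setT X -> (forall o, `|X o| <= sigma / 2) ->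
  (\int[P]_o (expR (X o ^+ 2 / sigma ^+ 2))%:E <= 2%:E)%E.
Proof.
move=> mX Xle.
have -> : 2%:E = (\int[P]_(o in setT) cst 2%:E o)%E.
  by rewrite integral_cst //= probability_setT mule1.
apply: ge0_le_integral => //.
  apply/measurable_EFinP/measurableT_comp => //.
  by apply: measurable_funM => //; exact: measurable_funX.
move=> o _; rewrite lee_fin.
have sqX : X o ^+ 2 / sigma ^+ 2 <= 1 / 2.
  rewrite ler_pdivrMr ?exprn_gt0 // -real_normK ?num_real //.
  have := Xle o; have := normr_ge0 (X o); nra.
apply: (@le_trans _ _ (expR (1 / 2))); first by rewrite ler_expR.
(* Inverting [1 - 1/2 <= exp(-1/2)] gives [exp(1/2) <= 2]. *)
have := expR_ge1Dx (- (1 / 2) : R); rewrite expRN => h.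
have e0 := expR_gt0 (1 / 2 : R).
rewrite -[leRHS]invrK -[leLHS]invrK lef_pV2 ?posrE ?invr_gt0 ?invr_gt0 //.
lra.
Qed.

Lemma psi2_le (mu : {measure set Omega -> \bar R}) (X : Omega -> R) :
  (\int[mu]_o (expR (X o ^+ 2 / sigma ^+ 2))%:E <= 2%:E)%E ->
  (psi2 mu X <= sigma%:E)%E.
Proof. by move=> h; apply: ereal_inf_lbound; exists sigma. Qed.

Lemma subgaussian_bounded (X : Omega -> Rn R 1) :
  measurable_fun setT X -> (forall o, `|X o 0 0| <= sigma / 2) ->
  subgaussian P X sigma.
Proof.
move=> mX Xle.
have mX0 : measurable_fun setT (fun o => X o 0 0).
  exact: measurableT_comp (measurable_coord 0) mX.
split.
  apply: ge_ereal_sup => _ [v /= v1 <-]; rewrite l2norm11 in v1.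
  apply: psi2_le; apply: integral_expR_sqr_le2.
    under eq_fun do rewrite dot11.
    exact: measurable_funM.
  move=> o; rewrite dot11 normrM -[leRHS]mulr1.
  exact: ler_pM.
apply: psi2_le; apply: integral_expR_sqr_le2.
  by under eq_fun do rewrite l2norm11; exact: measurableT_comp.
by move=> o; rewrite l2norm11 normr_id.
Qed.

End SubGaussianBounded.

(** Conditional laws live on the value space, so the bound is carried there by change of
    variables. *)
Lemma subgaussian_law dO (Omega : measurableType dO) (P : probability Omega R)
    (X : {mfun Omega >-> Rn R 1}) (sigma : R) :
  0 < sigma -> (forall o, `|X o 0 0| <= sigma / 2) ->
  subgaussian (distribution P X) (fun y : Rn R 1 => y : 'cV[R]_1) sigma.
Proof.
move=> sigma_gt0 Xle.
have mX0 : measurable_fun setT (fun o => X o 0 0).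
  exact: measurableT_comp (measurable_coord 0) _.
have law_le (f : Rn R 1 -> R) : measurable_fun setT f ->
    (forall o, `|f (X o)| <= sigma / 2) ->
    (psi2 (distribution P X) f <= sigma%:E)%E.
  move=> mf fle; apply: psi2_le => //.
  rewrite ge0_integral_distribution /=.
  - by apply: integral_expR_sqr_le2 => //; exact: measurableT_comp.
  - apply/measurable_EFinP/measurableT_comp => //.
    by apply: measurable_funM => //; exact: measurable_funX.
  - by move=> y; rewrite lee_fin expR_ge0.
split.
  apply: ge_ereal_sup => _ [v /= v1 <-]; rewrite l2norm11 in v1.
  have -> : (fun y : Rn R 1 => (y^T *m v) 0 0) =
      (fun y : Rn R 1 => y 0 0 * v 0 0) by apply/funext => y; exact: dot11.
  apply: law_le; first by apply: measurable_funM => //; exact: measurable_coord.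
  move=> o; rewrite normrM -[leRHS]mulr1.
  exact: ler_pM.
have -> : (@l2norm R 1 1 : Rn R 1 -> R) = (fun y : Rn R 1 => `|y 0 0|).
  by apply/funext => y; exact: l2norm11.
apply: law_le.
  by apply: measurableT_comp => //; exact: measurable_coord.
by move=> o; rewrite normr_id.
Qed.

End OneDimensional.

(** Both sides are 1 if [v] lies in every [B t] with [t < T], and 0 otherwise. *)
Lemma independent_cst (R : realType) dO (Omega : measurableType dO)
    d (E : measurableType d) (P : probability Omega R) (T : nat) (v : E) :
  independent_family P T (fun _ _ => v).
Proof.
move=> B mB; have preE t : (fun _ : Omega => v) @^-1` B t =
    if v \in B t then setT else set0.
  by apply/seteqP; split => o /=; case: ifPn; rewrite ?inE ?notin_setE.
have [Bv|/existsNP[t /not_implyP[tT nBv]]] :=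
  pselect (forall t, (t < T)%N -> B t v); last first.
  have -> : \bigcap_(t in `I_T) (fun _ : Omega => v) @^-1` B t = set0.
    by apply/seteqP; split => // o /(_ t tT).
  by rewrite measure0 (bigD1 (Ordinal tT)) //= preE memNset // measure0 mul0e.
have -> : \bigcap_(t in `I_T) (fun _ : Omega => v) @^-1` B t = setT.
  by apply/seteqP; split => // o _ t; exact: Bv.
rewrite probability_setT big1 // => i _.
by rewrite preE mem_set ?probability_setT //; exact: Bv.
Qed.

(** * Probability that every window of length [k] contains a flip *)

Section Windows.
Variables (R : realType) (T : nat) (p : R).
Hypothesis p01 : 0 <= p <= 1.

Let P : probability (flips T) R := flips_prob p01.

Lemma no_flip_in_window (k t : nat) : (k <= t)%N -> (t <= T)%N ->
  P [set o | forall j, (t - k <= j < t)%N -> flip j o = false] =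
  ((1 - p) ^+ k)%:E.
Proof.
move=> kt tT.
pose B j := if (t - k <= j < t)%N then [set false] else setT.
have -> : [set o | forall j, (t - k <= j < t)%N -> flip j o = false] =
    \bigcap_(j in `I_T) @flip T j @^-1` B j.
  apply/seteqP; split => o /= Ho j.
    by rewrite /B /= => _; case: ifP => // /Ho.
  move=> jt; have /andP[_ ltjt] := jt.
  by have := Ho j (leq_trans ltjt tT); rewrite /B /= jt.
rewrite (flips_independent T p01) // (eq_bigr (fun i : 'I_T =>
  (if (t - k <= i < t)%N then 1 - p else 1)%:E)); last first.
  move=> i _; rewrite /B; case: ifP => _.
    exact: (flips_prob_flip1 p01 false).
  by rewrite preimage_setT; exact: flips_prob_setT.
rewrite prodEFin; congr _%:E; rewrite -big_mkcond /=.
rewrite -(big_mkord (fun i => (t - k <= i < t)%N) (fun=> 1 - p)).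
(* Writing [k] as [t - (t - k)] turns the power into a product over the window, which is then
   extended to all indices below [T]. *)
rewrite -[in RHS](subKn kt) -prodr_const_nat [RHS](big_nat_widenl _ 0) //.
by rewrite [RHS](big_nat_widen _ _ T).
Qed.

(** Union bound over the end [t] of a window without flips. *)
Lemma flip_in_every_window (k : nat) :
  ((1 - T%:R * (1 - p) ^+ k)%:E <= P [set o | forall t, (k <= t < T)%N ->
     exists2 j, (t - k <= j < t)%N & flip j o])%E.
Proof.
set E := [set o | _].
have PC : P E = (1 - P (~` E))%E.
  by rewrite -[in LHS](setCK E) probability_setC.
rewrite PC EFinB leeB //.
(* Keeping [k <= t] inside the event makes it empty for small [t], where truncated subtraction would
   shorten the window. *)
pose Bad t : set (flips T) := [set o | (k <= t)%N /\
  forall j, (t - k <= j < t)%N -> flip j o = false].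
have EBad : ~` E `<=` \big[setU/set0]_(t < T) Bad t.
  move=> o /existsNP[t /not_implyP[/andP[kt tT] noflip]].
  rewrite -bigcup_mkord; exists t => //; split=> // j jt.
  by apply/negbTE/negP => jo; apply: noflip; exists j.
apply: (@le_trans _ _ (\sum_(t < T) P (Bad t))%E).
  exact: (@content_subadditive _ _ _ P).
have -> : (T%:R * (1 - p) ^+ k)%:E = (\sum_(t < T) ((1 - p) ^+ k)%:E)%E.
  by rewrite sumEFin sumr_const card_ord mulr_natl.
apply: lee_sum => t _; have [kt|tk] := leqP k t.
  rewrite -(no_flip_in_window kt (ltnW (ltn_ord t))).
  by apply: le_measure; rewrite ?inE // => o [].
rewrite (_ : Bad t = set0); last first.
  by apply/seteqP; split=> // o [kt]; rewrite leqNgt tk in kt.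
by rewrite measure0 lee_fin exprn_ge0 // subr_ge0; case/andP: p01.
Qed.

End Windows.

(** * The system and its Lipschitz constants *)

Section System.
Variable R : realType.

Definition leaky (rho : R) (x u w : 'cV[R]_1) : 'cV[R]_1 := rho *: (x + w).

Definition tent (s z : R) : R := Num.max 0 (1 - `|z| / s).

Definition hidden_gain (k s : R) (x u : 'cV[R]_1) : 'cV[R]_1 :=
  const_mx (k * u 0 0 * tent s (x 0 0)).

Lemma tent_le1 s z : 0 < s -> 0 <= tent s z <= 1.
Proof.
move=> s0; rewrite /tent le_max lexx /= ge_max ler01 /= lerBlDr lerDl.
by rewrite divr_ge0 // ltW.
Qed.

(** [1 - |z| / s] is Lipschitz with constant [1 / s], and taking the maximum with 0 does not
    increase distances. *)
Lemma tent_lipschitz s y z : 0 < s -> `|tent s y - tent s z| <= `|y - z| / s.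
Proof.
move=> s0; have si : 0 < s^-1 by rewrite invr_gt0.
have yz : `| `|y| / s - `|z| / s| <= `|y - z| / s.
  rewrite -mulrBl normrM (gtr0_norm si) ler_pM2r //; exact: ler_dist_dist.
apply: le_trans yz; rewrite /tent.
move: (`|y| / s) (`|z| / s) => a b.
rewrite !maxEle; do 2 case: ifPn => /=; rewrite -?ltNge => ha hb;
  rewrite ler_norml; have := ler_norm (a - b); have := ler_norm (b - a);
  rewrite (distrC b a) => h1 h2; lra.
Qed.

(** The slope [1 / s] of the tent is compensated by [|u| <= s], which is why the inputs are confined
    to [[-s, s]]. *)
Lemma hidden_gain_lipschitz (k s L : R) (x x' u u' : 'cV[R]_1) :
  0 < s -> `|k| <= L -> `|u 0 0| <= s ->
  l2norm (hidden_gain k s x u - hidden_gain k s x' u') <=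
  L * (l2norm (x - x') + l2norm (u - u')).
Proof.
move=> s0 kL us; rewrite !l2norm11 !mxE.
have -> : k * u 0 0 * tent s (x 0 0) - k * u' 0 0 * tent s (x' 0 0) =
    k * (u 0 0 * (tent s (x 0 0) - tent s (x' 0 0)) +
         (u 0 0 - u' 0 0) * tent s (x' 0 0)) by ring.
rewrite normrM; apply: ler_pM => //.
apply: (le_trans (ler_normD _ _)); rewrite !normrM; apply: lerD.
  apply: (@le_trans _ _ (s * (`|x 0 0 - x' 0 0| / s))).
    by apply: ler_pM => //; exact: tent_lipschitz.
  by rewrite mulrC divfK // gt_eqF.
have /andP[t0 t1] := tent_le1 (x' 0 0) s0.
by rewrite (ger0_norm t0) -[leRHS]mulr1 ler_pM.
Qed.

(** The dynamics are linear and ignore the input, so equal later disturbances cancel and each step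
    contributes one factor [rho]. *)
Lemma flow_leaky_sub (rho : R) k (x x' : 'cV[R]_1) us us' ws ws' :
  (forall i, (0 < i < k.+1)%N -> ws i = ws' i) ->
  flow (leaky rho) k.+1 x us ws - flow (leaky rho) k.+1 x' us' ws' =
  rho ^+ k.+1 *: ((x - x') + (ws 0%N - ws' 0%N)).
Proof.
elim: k => [_|k IH wsE].
  by rewrite /= /leaky expr1 -scalerBr opprD addrACA.
rewrite -[LHS]/(rho *: (flow (leaky rho) k.+1 x us ws + ws k.+1) -
  rho *: (flow (leaky rho) k.+1 x' us' ws' + ws' k.+1)) -scalerBr.
rewrite (wsE k.+1) ?ltnSn // opprD addrACA subrr addr0 IH ?scalerA -?exprS //.
by move=> i /andP[i0 ik]; apply: wsE; rewrite i0 ltnW.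
Qed.

Lemma lipschitz_system (rho L k s : R) :
  0 <= rho -> 0 < s -> `|k| <= L ->
  lipschitz_assumption [set u : 'cV[R]_1 | `|u 0 0| <= s]
    (leaky rho) (hidden_gain k s) L 1 rho.
Proof.
move=> rho0 s0 kL; split.
- by move=> x x' u u' /= us _; exact: hidden_gain_lipschitz.
- case=> // n _ x x' us us' ws ws' _ wsE.
  rewrite flow_leaky_sub => [|i /wsE[] //].
  rewrite !l2norm11 mul1r [X in `|X|]mxE normrM ger0_norm ?exprn_ge0 //.
  apply: ler_wpM2l; rewrite ?exprn_ge0 // mxE.
  apply: (le_trans (ler_normD _ _)); rewrite lerD2r lerDl; exact: normr_ge0.
- by split; rewrite /= ?mxE ?normr0 ?ltW // /leaky addr0 scaler0.
Qed.

Lemma flow_leaky0 (rho : R) k us : flow (leaky rho) k 0 us (fun=> 0) = 0.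
Proof. by elim: k => //= k ->; rewrite /leaky addr0 scaler0. Qed.

End System.

(** * The attacked trajectory and the assumptions on its disturbances *)

Section AttackedSystem.
Variables (R : realType) (T : nat) (p rho sigma : R).
Hypotheses (p01 : 0 <= p <= 1) (rho_gt0 : 0 < rho) (sigma_gt0 : 0 < sigma).

Let P : probability (flips T) R := flips_prob p01.

(** [sigma / 2] is the largest amplitude that [subgaussian_bounded] accepts. *)
Definition attack (t : nat) (o : flips T) : Rn R 1 :=
  const_mx (if flip t o then sigma / 2 else 0) : 'cV[R]_1.

Definition initial_state (o : flips T) : Rn R 1 :=
  const_mx (sigma / 2) : 'cV[R]_1.

Definition state (u : nat -> flips T -> 'cV[R]_1) :=
  trajectory (leaky rho) initial_state u attack.

Lemma attack_ge0 t o : 0 <= attack t o 0 0.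
Proof. by rewrite mxE; case: ifP => // _; rewrite divr_ge0 // ltW. Qed.

Lemma attack_le t o : `|attack t o 0 0| <= sigma / 2.
Proof.
rewrite (ger0_norm (attack_ge0 t o)) mxE; case: ifP => // _.
by rewrite divr_ge0 // ltW.
Qed.

Lemma stateS u t o :
  state u t.+1 o 0 0 = rho * (state u t o 0 0 + attack t o 0 0).
Proof. by rewrite /state /trajectory /= /leaky !mxE. Qed.

Lemma state_ge0 u t o : 0 <= state u t o 0 0.
Proof.
elim: t => [|t IH]; first by rewrite mxE divr_ge0 // ltW.
by rewrite stateS mulr_ge0 ?addr_ge0 ?attack_ge0 // ltW.
Qed.

(** Attacks are non-negative, so dropping them only lowers the state. *)
Lemma state_decay u k t o :
  rho ^+ k * state u t o 0 0 <= state u (k + t)%N o 0 0.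
Proof.
elim: k => [|k IH]; first by rewrite expr0 mul1r.
rewrite addSn stateS exprS -mulrA; apply: ler_wpM2l; first exact: ltW.
by apply: (le_trans IH); rewrite lerDl attack_ge0.
Qed.

Lemma state_ge_initial u t o : rho ^+ t * (sigma / 2) <= state u t o 0 0.
Proof. by have := state_decay u t 0 o; rewrite addn0 [state _ 0 _ _ _]mxE. Qed.

Lemma state_ge_attack u j t o : (j < t)%N -> flip j o ->
  rho ^+ (t - j) * (sigma / 2) <= state u t o 0 0.
Proof.
(* The attack at time [j] enters the state at time [j.+1], already multiplied by [rho]; [t - j.+1]
   steps of decay remain. *)
move=> jt jo; apply: le_trans (_ : rho ^+ (t - j.+1) * state u j.+1 o 0 0 <= _).
  rewrite stateS mxE jo -(subnSK jt) exprSr -!mulrA.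
  apply: ler_wpM2l; first by rewrite exprn_ge0 // ltW.
  apply: ler_wpM2l; first exact: ltW.
  by rewrite lerDr state_ge0.
by apply: le_trans (state_decay _ _ _ _) _; rewrite subnK.
Qed.

Lemma state_determined u t (o o' : flips T) :
  (forall i, u i o = u i o') ->
  (forall i : 'I_T, (i < t)%N -> o i = o' i) -> state u t o = state u t o'.
Proof.
move=> uE; elim: t => // t IH oo'.
rewrite /state /trajectory /= -!/(trajectory _ _ _ _ _ _) -!/(state _ _ _) uE.
rewrite IH => [|i it]; last by apply: oo'; rewrite ltnW.
congr leaky; congr const_mx; rewrite /flip.
by case: insubP => //= i _ it; rewrite oo' // it.
Qed.

(** With deterministic inputs, the states up to time [t] involve only the attacks before [t], so the
    history does not see flip [t]. *)
Lemma history_determined u t (A : set (flips T)) :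
  (forall i o o', u i o = u i o') ->
  <<s history (state u) t >> A -> determined t A.
Proof.
move=> uE; apply: sigma_determined => _ [s /= st [B _ <-]] o o' oo' [_ Bo].
split=> //=; rewrite -(@state_determined u s o o') // => i si.
exact/oo'/(leq_trans si).
Qed.

Lemma disturbance_attack u :
  (forall i o o', u i o = u i o') ->
  disturbance_assumption P T (state u) attack sigma.
Proof.
move=> uE; split => //.
  apply: subgaussian_bounded => // o.
  by rewrite mxE ger0_norm // divr_ge0 // ltW.
move=> t tT; split => //.
pose mW := isMeasurableFun.Build _ _ _ _ (attack t)
  (measurable_fun_flips (attack t)).
pose W : {mfun flips T >-> Rn R 1} := HB.pack (attack t) mW.
pose law : pprobability (Rn R 1) R := distribution P W : probability _ _.
(* The kernel is constant: [attack t] is independent of the history, so its conditional law is its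
   law. *)
exists (kprobability (measurable_cst (law : pprobability _ _)
  : measurable_fun [set: g_sigma_algebraType (history (state u) t)] (cst law))).
  move=> A B FA mB.
  rewrite integral_cst //=.
  have -> : attack t @^-1` B = flip t @^-1`
      [set b | B (const_mx (if b then sigma / 2 else 0) : 'cV[R]_1)] by [].
  rewrite (flips_prob_indep p01 _ tT (history_determined uE FA)).
  by rewrite muleC.
apply: aeW => o; apply: (@subgaussian_law _ _ _ P W) => // o'.
exact: attack_le.
Qed.

Lemma attack_probability u tau :
  (forall i o o', u i o = u i o') -> p < (2 * tau%:R)^-1 ->
  attack_assumption P T tau (state u) attack p.
Proof.
move=> uE ptau; have /andP[p0 _] := p01; split => //.
exists (@flip T); split => //.
- exact: flips_independent.
- by move=> t tT; exact: (flips_prob_flip1 p01 true).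
- move=> t tT A FA.
  rewrite (flips_prob_indep p01 _ tT (history_determined uE FA)) muleC.
  by congr (_ * _)%E; exact: (flips_prob_flip1 p01 true).
- by move=> t tT o to; rewrite /attack to.
Qed.

End AttackedSystem.

(** * Numerical estimates *)

Lemma entry_le_l2norm (R : realType) m n (A : 'M[R]_(m, n)) i j :
  `|A i j| <= l2norm A.
Proof.
have sq0 i' j' : 0 <= A i' j' ^+ 2 by exact: sqr_ge0.
rewrite -sqrtr_sqr ler_wsqrtr // (bigD1 i) //= (bigD1 j) //= -addrA lerDl.
by rewrite addr_ge0 ?sumr_ge0 // => i' _; exact: sumr_ge0.
Qed.

(** The right-hand side is [rho] to the exponent [m - a <= 1 <= tau], and powers of [rho < 1]
    decrease with the exponent. *)
Lemma expr_powR_ge (R : realType) (rho a : R) (m tau : nat) :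
  0 < rho < 1 -> (0 < tau)%N -> m%:R <= a + 1 ->
  rho ^+ tau <= rho ^+ m * rho^-1 `^ a.
Proof.
move=> /andP[r0 r1] tau0 ma; have r0' := ltW r0.
rewrite -(powR_inv1 r0') -powRrM -!powR_mulrn // -powRD; last first.
  by rewrite (gt_eqF r0) implybT.
apply: ger_powR; first by rewrite r0 ltW.
have : 1 <= tau%:R :> R by rewrite ler1n.
lra.
Qed.

(** Put [p = 1 / (4 * tau)]. Then [1 - p <= exp(-p)] bounds the left side by [T * exp(-k * p)], and
    the factor 4 in the hypothesis gives [k * p >= ln (T / delta)]. *)
Lemma attack_rate_bound (R : realType) (delta a : R) (tau T k : nat) :
  0 < delta -> (0 < tau)%N -> (0 < T)%N ->
  4 * (tau%:R * ln (T%:R / delta)) <= a -> a <= k%:R ->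
  T%:R * (1 - (4 * tau%:R)^-1) ^+ k <= delta.
Proof.
move=> d0 tau0 T0 aln ak.
have tauR : 0 < tau%:R :> R by rewrite ltr0n.
have TR : 0 < T%:R :> R by rewrite ltr0n.
have tau1 : 1 <= tau%:R :> R by rewrite ler1n.
set p := (4 * tau%:R)^-1.
have p0 : 0 < p by rewrite invr_gt0 mulr_gt0.
have p1 : p <= 1 by rewrite invf_le1 ?mulr_gt0 //; lra.
have lnk : ln (T%:R / delta) <= k%:R * p.
  by rewrite ler_pdivlMr ?mulr_gt0 //; lra.
rewrite mulrC -ler_pdivlMr //.
apply: (@le_trans _ _ (expR (- p) ^+ k)).
  by apply: lerXn2r; rewrite ?nnegrE ?expR_ge0 ?subr_ge0 ?expR_ge1Dx.
rewrite -expRM_natl mulrN expRN -[leRHS]invrK invf_div.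
rewrite lef_pV2 ?posrE ?expR_gt0 ?divr_gt0 //.
by rewrite -[leLHS]lnK ?posrE ?divr_gt0 // ler_expR.
Qed.

(** * The state stays above [s] with probability at least [1 - delta] *)

Section LargeState.
Variables (R : realType) (T tau : nat) (rho delta a s : R).
Let p : R := (4 * tau%:R)^-1.
Let sigma : R := rho^-1 `^ a.
Hypotheses (p01 : 0 <= p <= 1) (rho01 : 0 < rho < 1) (delta_gt0 : 0 < delta)
  (delta_le1 : delta <= 1) (tau_gt0 : (0 < tau)%N) (T_gt0 : (0 < T)%N)
  (a_ge : 4 * (tau%:R * ln (T%:R / delta)) <= a) (s_le : s <= rho ^+ tau / 2).

Lemma state_large (u : nat -> flips T -> 'cV[R]_1) :
  ((1 - delta)%:E <= (flips_prob p01 : probability (flips T) R)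
     [set o | forall t, (t < T)%N ->
       (s <= state rho sigma u t o 0 0)%R])%E.
Proof.
have a0 : 0 <= a.
  apply: le_trans a_ge; rewrite !mulr_ge0 // ln_ge0 // ler_pdivlMr // mul1r.
  by apply: (le_trans delta_le1); rewrite ler1n.
have /andP[k_le k_gt] := Num.Theory.truncn_itv a0.
(* The integer part of [a] plus one: [a <= k] serves the union bound, [k <= a + 1] the decay
   estimate. *)
set k := (Num.truncn a).+1.
have [rho0 _] := andP rho01.
have sigma0 : 0 < sigma by rewrite powR_gt0 // invr_gt0.
have large m : (m <= k)%N -> s <= rho ^+ m * (sigma / 2).
  move=> mk; apply: (le_trans s_le); rewrite mulrA ler_pM2r ?invr_gt0 //.
  apply: expr_powR_ge => //.
  apply: (@le_trans _ _ k%:R); first by rewrite ler_nat.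
  by rewrite -natr1 lerD2r.
apply: (le_trans _ (le_trans (flip_in_every_window T p01 k) _)).
  rewrite lee_fin lerD2l lerN2.
  by apply: (attack_rate_bound (a := a)) => //; exact: ltW.
apply: le_measure; rewrite ?inE // => o Ho t tT.
(* Before time [k] no complete window has passed, and the initial state plays the role of an
   attack. *)
have [kt|tk] := leqP k t; last first.
  apply: le_trans (large t (ltnW tk)) _.
  exact: state_ge_initial.
have [j /andP[tkj jt] jo] : exists2 j, (t - k <= j < t)%N & flip j o.
  by apply: Ho; rewrite kt.
apply: le_trans (large (t - j)%N _) _; first by rewrite leq_subCl.
exact: state_ge_attack.
Qed.

End LargeState.

(** * The basis function and the true input-output map *)

Section Instance.
Variables (R : realType) (T tau : nat) (lambda s : R).
Hypotheses (lambda_gt0 : 0 < lambda) (s_gt0 : 0 < s).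

Let U := [set u : 'cV[R]_1 | `|u 0 0| <= s].

(** [V 0 0] is the current input. The scale makes the feature equal to [lambda] at the constant
    input [s], so its second moment there is exactly [lambda ^+ 2]. *)
Definition basis (V : 'M[R]_(1, tau.+1)) : 'cV[R]_1 :=
  const_mx (lambda / s * V 0 0).

Lemma basis_constant_input dO (O : measurableType dO)
    (P : probability O R) :
  basis_assumption P T U (fun _ _ => const_mx s) basis (lambda / s) lambda.
Proof.
have ls0 : 0 <= lambda / s by rewrite divr_ge0 // ltW.
split.
- move=> i V V' _ _; rewrite !mxE -mulrBr normrM ger0_norm //.
  apply: ler_wpM2l => //.
  by have := entry_le_l2norm (V - V') 0 0; rewrite !mxE.
- move=> t _.
  have -> : second_moment P (fun o => basis (input_window tau
      (fun _ _ => const_mx s) t o)) = (lambda ^+ 2)%:M.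
    apply/matrixP => i j; rewrite !ord1 !mxE eqxx mulr1n.
    have -> : (fun o : O => basis (input_window tau (fun _ _ => const_mx s) t o)
        0 0 * basis (input_window tau (fun _ _ => const_mx s) t o) 0 0) =
        cst (lambda ^+ 2).
      by apply/funext => o; rewrite !mxE divfK ?gt_eqF.
    by rewrite expectation_cst.
  rewrite subrr; split; first by rewrite trmx0.
  by move=> v; rewrite mulmx0 mul0mx mxE.
- by apply/matrixP => i j; rewrite !mxE mulr0.
Qed.

(** The unattacked state stays at 0, where the tent equals 1; dividing the gain [k] by the scale
    [lambda / s] of [basis] gives the coefficient, with zero approximation error. *)
Lemma io_hidden_gain (rho k epsbar : R) : 0 <= epsbar ->
  io_representation U (leaky rho) (hidden_gain k s) basis
    (const_mx (k * (s / lambda)) : 'M[R]_1) epsbar.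
Proof.
move=> e0 V _; rewrite l2norm11 /io_map flow_leaky0 !mxE big_ord1 !mxE.
rewrite /tent normr0 mul0r subr0 max_r // mulr1.
rewrite (_ : k * _ * _ = k * V 0 0) ?subrr ?normr0 //.
by field; rewrite !gt_eqF.
Qed.

End Instance.

(** * The two-point argument and the lower bound *)

Lemma sign_far (R : realType) (z x : R) : 0 <= z ->
  exists2 e : R, `|e| = 1 & z <= `|e * z - x|.
Proof.
(* The points [z] and [- z] are [2 * z] apart; the one across 0 from [x] is at distance at least
   [z]. *)
move=> z0; have [x0|x0] := leP x 0.
  exists 1; rewrite ?normr1 // mul1r; apply: le_trans (ler_norm _); lra.
exists (-1); rewrite ?normrN1 // distrC; apply: le_trans (ler_norm _); lra.
Qed.

Theorem theorem3p5 (R : realType) (sigma_u : R) (sigma_u_gt0 : 0 < sigma_u) :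
  exists C c1 c2 : R, [/\ 0 < C, 0 < c1 & 0 < c2] /\
  forall (delta rho L lambda epsbar a sigma_w : R) (tau T : nat),
    0 < delta <= 1 -> 0 < rho < 1 -> 0 < L -> 0 < lambda -> 0 <= epsbar ->
    (0 < tau)%N -> (0 < T)%N ->
    c1 * (tau%:R * ln (T%:R / delta)) <= a -> sigma_w = rho^-1 `^ a ->
  exists (n m d r M : nat) (U : set 'cV[R]_m)
    (f : 'cV[R]_n -> 'cV[R]_m -> 'cV[R]_d -> 'cV[R]_n)
    (Phi : 'M[R]_(m, tau.+1) -> 'cV[R]_M) (Lphi p : R)
    (dO : measure_display) (Omega : measurableType dO) (P : probability Omega R)
    (x0 : Omega -> 'cV[R]_n) (u : nat -> Omega -> 'cV[R]_m)
    (w : nat -> Omega -> 'cV[R]_d),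
  [/\ (0 < n)%N, (0 < m)%N, (0 < d)%N, (0 < r)%N & (0 < M)%N] /\ 0 < Lphi /\
  forall Ghat : estimator R m r M T,
  exists (g : 'cV[R]_n -> 'cV[R]_m -> 'cV[R]_r) (Gstar : 'M[R]_(r, M)),
  let x := trajectory f x0 u w in
  [/\ lipschitz_assumption U f g L C rho,
      basis_assumption P T U u Phi Lphi lambda,
      input_assumption P T U u sigma_u,
      disturbance_assumption P T x w sigma_w
    & attack_assumption P T tau x w p] /\
  io_representation U f g Phi Gstar epsbar /\
  exists E : set Omega,
    [/\ measurable E, ((1 - delta)%:E <= P E)%E &
      forall o, E o ->
        c2 * (rho ^+ tau * L / lambda) <=
          l2norm (Gstar - estimate Ghat g x u o)].
Proof.
(* The 1 in the minimum yields [s <= rho ^+ tau / 2] for [state_large], and [sigma_u] yields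
   [s <= sigma_u / 2] for sub-Gaussian inputs. *)
pose c0 := Num.min sigma_u 1 / 2.
have c0_gt0 : 0 < c0 by rewrite divr_gt0 // lt_min sigma_u_gt0 ltr01.
exists 1, 4, c0; split => //.
move=> delta rho L lambda epsbar a sigma_w tau T /andP[d0 d1] rho01 L0 lambda0
  eps0 tau0 T0 a_ge ->.
have /andP[rho0 rho1] := rho01.
have rhotau0 : 0 < rho ^+ tau by rewrite exprn_gt0.
have rhotau1 : rho ^+ tau <= 1 by rewrite exprn_ile1 // ltW.
have sigma0 : 0 < rho^-1 `^ a by rewrite powR_gt0 // invr_gt0.
have tau_ge1 : 1 <= tau%:R :> R by rewrite ler1n.
(* Half of the excluded bound [1 / (2 * tau)], so that the required inequality is strict. *)
pose p : R := (4 * tau%:R)^-1.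
have p01 : 0 <= p <= 1.
  by rewrite invr_ge0 mulr_ge0 //= invf_le1 ?mulr_gt0 ?ltr0n //; lra.
pose s := c0 * rho ^+ tau.
have s0 : 0 < s by exact: mulr_gt0.
have s_half : s <= rho ^+ tau / 2.
  by rewrite /s mulrC ler_pM2l // /c0 ler_pdivrMr // mulVf // ge_min lexx orbT.
have s_sigma_u : s <= sigma_u / 2.
  apply: (@le_trans _ _ (c0 * 1)); first by rewrite ler_pM2l.
  by rewrite mulr1 ler_pM2r // ge_min lexx.
pose u (_ : nat) (_ : flips T) : 'cV[R]_1 := const_mx s.
exists 1%N, 1%N, 1%N, 1%N, 1%N, [set v : 'cV[R]_1 | `|v 0 0| <= s].
exists (leaky rho), (@basis R tau lambda s), (lambda / s), p.
exists _, (flips T), (flips_prob p01 : probability (flips T) R).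
exists (initial_state (rho^-1 `^ a)), u, (attack (rho^-1 `^ a)).
split=> //; split; first exact: divr_gt0.
move=> Ghat.
(* The sign is chosen against the answer to constant inputs and zero outputs. These data do not
   depend on the sign, so there is no circularity and one sign serves all outcomes. *)
have [e e1 far] := sign_far
  (Ghat (\matrix_(i, t) s) 0 0 0) (ltW (divr_gt0 (mulr_gt0 L0 s0) lambda0)).
exists (hidden_gain (e * L) s), (const_mx (e * L * (s / lambda))) => x.
split.
  split.
  - apply: lipschitz_system => //; first exact: ltW.
    by rewrite normrM e1 mul1r gtr0_norm.
  - exact: basis_constant_input.
  - split=> [t _||t _].
    + by split=> // o; rewrite /= mxE gtr0_norm.
    + exact: independent_cst.
    + by apply: subgaussian_bounded => // o; rewrite mxE gtr0_norm.
  - exact: disturbance_attack.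
  - apply: attack_probability => //.
    by rewrite ltf_pV2 ?posrE ?mulr_gt0 ?ltr0n // ltr_pM2r ?ltr0n // ltr_nat.
split; first exact: io_hidden_gain.
exists [set o | forall t, (t < T)%N -> s <= x t o 0 0]; split => //.
  exact: state_large.
move=> o large.
(* On this event the tent vanishes at every observed state, whatever the sign [e]. *)
have zero_output :
    \matrix_(i, t) hidden_gain (e * L) s (x t o) (u t o) i 0 = 0
    :> 'M[R]_(1, T).
  apply/matrixP => i t; rewrite !mxE /tent max_l ?mulr0 // subr_le0.
  rewrite ler_pdivlMr // mul1r; apply: le_trans (ler_norm _).
  exact: large.
rewrite l2norm11 /estimate zero_output.
have -> : \matrix_(i, t) u t o i 0 = \matrix_(i, t) s :> 'M[R]_(1, T).
  by apply/matrixP => i t; rewrite !mxE.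
rewrite !mxE (_ : e * L * (s / lambda) = e * (L * s / lambda)); last by ring.
apply: le_trans far.
by rewrite le_eqVlt; apply/orP; left; apply/eqP; rewrite /s; ring.
Qed.
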